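(* Let $\Bbbk$ be a field of positive characteristic $p>2$ and let $Y$ be an $n\times n$ symmetric matrix of indeterminates, where $n\geq 2$. Then: (1) the ring $\Bbbk[Y]/\sqrt{P_2(Y)}$ is $F$-pure; (2) the ring $\Bbbk[Y]/\sqrt{P_2(Y)}$ is $F$-regular if and only if $n=2$.
   Context: An $n\times n$ symmetric matrix of indeterminates is a matrix $Y=(y_{ij})$ with $y_{ij}=y_{ji}$ for all $i,j$ and with the entries $y_{ij}$, $i\le j$, distinct indeterminates; $\Bbbk[Y]$ is the polynomial ring over $\Bbbk$ in these indeterminates. The permanent of a $2\times 2$ matrix $\begin{pmatrix} a&b\\ c&d\end{pmatrix}$ is $ad+bc$. $P_2(Y)$ denotes the ideal of $\Bbbk[Y]$ generated by the permanents of all $2\times 2$ submatrices of $Y$ (obtained by choosing two distinct rows and two distinct columns), and $\sqrt{P_2(Y)}$ is its radical. Let $R$ be a quotient of a standard graded polynomial ring over a field of characteristic $p>0$ by a homogeneous ideal. For an ideal $J=(m_1,\dots,m_k)$ of $R$ and $q=p^e$ with $e$ a positive integer, $J^{[q]}=(m_1^q,\dots,m_k^q)$. The Frobenius closure $J^F$ is the set of $r\in R$ with $r^q\in J^{[q]}$ for some $q=p^e$. The tight closure $J^*$ is the set of $r\in R$ for which there is a non-zerodivisor $c$ of $R$ such that $cr^q\in J^{[q]}$ for all sufficiently large $q=p^e$. The ring $R$ is called $F$-pure if $J=J^F$ for every ideal $J$ of $R$, and $F$-regular if $J=J^*$ for every ideal $J$ of $R$. *)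

(* Defs.v *)
From HB Require Import structures.
From mathcomp Require Import all_boot all_order all_algebra.
From mathcomp Require Import ring_quotient.
From mathcomp Require Import boolp classical_sets.
From mathcomp Require Import mpoly.

Set Implicit Arguments.
Unset Strict Implicit.
Unset Printing Implicit Defensive.

Import GRing.Theory.

Local Open Scope classical_set_scope.
Local Open Scope ring_scope.

Section Ideals.
Variable R : comNzRingType.
Implicit Types (I J G : set R) (a x y : R).

Definition is_ideal I : Prop :=
  [/\ I 0, (forall x y, I x -> I y -> I (x + y)) & (forall a x, I x -> I (a * x))].

Definition ideal_gen G : set R := smallest is_ideal G.

Definition radical I : set R := [set x | exists m : nat, I (x ^+ m)].

Lemma ideal_gen_ideal G : is_ideal (ideal_gen G).
Proof.
split=> [I [[] //]|x y Gx Gy I IG|a x Gx I IG].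
- by case: (IG) => -[_ + _] _; apply; [apply: Gx|apply: Gy].
- by case: (IG) => -[_ _ +] _; apply; apply: Gx.
Qed.

Lemma is_ideal_sum I (s : nat) (F : 'I_s -> R) : is_ideal I ->
  (forall i, I (F i)) -> I (\sum_i F i).
Proof. by case=> I0 ID _ IF; apply: big_ind => // i _; apply: IF. Qed.

Lemma radical_ideal I : is_ideal I -> is_ideal (radical I).
Proof.
move=> Iid; case: (Iid) => I0 ID IM; split.
- by exists 1%N; rewrite expr1.
- move=> x y [m Ix] [l Iy]; exists (m + l)%N; rewrite exprDn.
  apply: is_ideal_sum => // i; rewrite -mulr_natl; apply: (IM).
  have [le_li|lt_il] := leqP l i.
    by rewrite -(subnK le_li) exprD mulrA; apply: IM.
  have le_m : (m <= m + l - i)%N by rewrite -addnBA ?leq_addr // ltnW.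
  by rewrite -(subnK le_m) exprD mulrAC; apply: IM.
- by move=> a x [m Ix]; exists m; rewrite exprMn; apply: IM.
Qed.

End Ideals.

Section Closures.
Variables (p : nat) (R : comNzRingType).
Implicit Types (G : set R) (q : nat).

(* J^[q] for the ideal J generated by G.  The family G is arbitrary: a finite
   G is a presentation J = (m_1, ..., m_k), and G := J presents every ideal J.
   In characteristic p the result depends only on J, see
   [frobenius_power_ideal_gen]. *)
Definition frobenius_power G q : set R := ideal_gen [set g ^+ q | g in G].

Definition frobenius_closure G : set R :=
  [set r | exists2 e : nat, (0 < e)%N & frobenius_power G (p ^ e) (r ^+ (p ^ e))].

(* [GRing.lreg c] says that c is a non-zerodivisor. *)
Definition tight_closure G : set R :=
  [set r | exists2 c : R, GRing.lreg c &
     exists e0 : nat, forall e : nat, (e0 <= e)%N ->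
       frobenius_power G (p ^ e) (c * r ^+ (p ^ e))].

Definition F_pure : Prop := forall G, ideal_gen G = frobenius_closure G.

Definition F_regular : Prop := forall G, ideal_gen G = tight_closure G.

Lemma frobenius_power_ideal_gen G e : p \in [pchar R] ->
  frobenius_power (ideal_gen G) (p ^ e) = frobenius_power G (p ^ e).
Proof.
move=> charRp; have [P0 PD PM] := ideal_gen_ideal [set g ^+ (p ^ e) | g in G].
have p_gt0 : (0 < p ^ e)%N by rewrite expn_gt0 prime_gt0 ?(pcharf_prime charRp).
have charX : [pchar R].-nat (p ^ e)%N by rewrite pnatX (pnatE _ (pcharf_prime charRp)) charRp.
apply/seteqP; split; apply: smallest_sub; try exact: ideal_gen_ideal.
- move=> _ [x Gx <-].
  apply: (Gx [set x | frobenius_power G (p ^ e) (x ^+ (p ^ e))]); split; last first.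
    by move=> g Gg; apply: sub_gen_smallest; exists g.
  split=> [|y z Py Pz|a y Py] /=.
  - by rewrite expr0n gtn_eqF.
  - by rewrite exprDn_pchar //; apply: PD.
  - by rewrite exprMn; apply: PM.
- move=> _ [g Gg <-]; apply: sub_gen_smallest; exists g => //.
  exact: sub_gen_smallest.
Qed.

End Closures.

Section Permanents.
Variable R : comNzRingType.

Definition permanent2 (A : 'M[R]_2) : R :=
  A ord0 ord0 * A ord_max ord_max + A ord0 ord_max * A ord_max ord0.

(* Reordering the two rows or the two columns of a 2 x 2 matrix does not change
   its permanent, so injections select the same permanents as pairs of
   increasing indices. *)
Definition P2 m n (A : 'M[R]_(m, n)) : set R :=
  ideal_gen [set u | exists (f : 'I_2 -> 'I_m) (g : 'I_2 -> 'I_n),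
    [/\ injective f, injective g & u = permanent2 (mxsub f g A)]].

End Permanents.

Section GenericSymmetricMatrix.
Variables (K : fieldType) (n : nat).

(* The indeterminates are indexed by the pairs (i, j) with i <= j, enumerated
   by [enum_rank]. *)
Definition upper_index := {ij : 'I_n * 'I_n | (ij.1 <= ij.2)%N}.

Definition sort_pair (i j : 'I_n) := if (i <= j)%N then (i, j) else (j, i).

Fact sort_pair_le i j : ((sort_pair i j).1 <= (sort_pair i j).2)%N.
Proof. by rewrite /sort_pair; have [|/ltnW] := leqP i j. Qed.

Definition upper (i j : 'I_n) : upper_index :=
  exist _ (sort_pair i j) (sort_pair_le i j).

Local Notation S := {mpoly K[#|{: upper_index}|]}.

Definition sym_mx : 'M[S]_n := \matrix_(i, j) 'X_(enum_rank (upper i j)).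

Definition rad_P2 : pred S := fun u => `[< radical (P2 sym_mx) u >].

Fact rad_P2_idealr : idealr_closed rad_P2.
Proof.
have [R0 RD RM] := radical_ideal (ideal_gen_ideal _ : is_ideal (P2 sym_mx)).
split; first exact/asboolP.
- apply/asboolP => -[m]; rewrite expr1n => P1.
  suff : (1 : S).@[fun=> 0] = 0.
    by rewrite rmorph1 => /eqP; rewrite oner_eq0.
  apply: (P1 [set u : S | u.@[fun=> 0] = 0]); split.
    split=> [|x y /= x0 y0|a x /= x0]; first exact: rmorph0.
      by rewrite rmorphD /= x0 y0 addr0.
    by rewrite rmorphM /= x0 mulr0.
  move=> _ [f] [g] [_ _ ->] /=.
  by rewrite /permanent2 !mxE rmorphD !rmorphM /= !mevalXU !mul0r addr0.
- by move=> a x y /asboolP Rx /asboolP Ry; apply/asboolP/RD => //; apply: RM.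
Qed.

HB.instance Definition _ := isIdealr.Build S rad_P2 rad_P2_idealr.

Definition rad_P2_ideal : idealr S := rad_P2.

Definition sym_perm_quot : comNzRingType := {ideal_quot rad_P2_ideal}.

End GenericSymmetricMatrix.

Arguments rad_P2 K n u : clear implicits.
Arguments rad_P2_ideal K n : clear implicits.
Arguments sym_perm_quot K n : clear implicits.
Arguments sym_mx K n : clear implicits.

(* Main.v *)
Require Import Defs.
From HB Require Import structures.
From mathcomp Require Import all_boot all_order all_algebra.
From mathcomp Require Import ring_quotient boolp classical_sets mpoly.
From mathcomp Require Import zify ring.

(** For indices k <> l let phi_kl : K[Y] -> K[s,t] send y_kk to s^2, y_kl to
    s t, y_ll to -t^2 and every other entry of Y to 0.  All 2 x 2 permanents
    of Y die under phi_kl, and the radical of P_2(Y) is exactly the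
    intersection of the kernels of the maps phi_kl ([rad_P2E]).  For this,
    the kernel of phi_kl is generated by the quadric y_kk y_ll + y_kl^2 and
    the entries outside the block {k, l} ([pair_map_ker]); a product of such
    generators, one for each pair, always contains a factor that is in the
    radical: the quadric of a pair, a product of two entries that do not fit in
    a common block, or a product of three distinct diagonal entries.  Since 2
    is invertible, relations between the permanents of a symmetric matrix put
    the last two kinds in the radical.
    Hence the quotient R embeds in the product of the K[s,t]: it is the
    coordinate ring of one surface for each block {k, l}, the quotient of a plane
    by (s,t) -> (-s,-t), and these are glued along the images of the axes.

    Both closures are controlled by additive maps f with f(a^q x) = a f(x): if
    moreover f(c) = 1, then c r^q in J^[q] implies r in J ([cartier_ideal]).
    Such maps exist on K (split off K^q as a K^q-subspace of K), and are
    extended to K[s,t] by taking one residue class of exponents modulo q.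

    F-purity: the map of K[s,t] that keeps the exponents divisible by q and
    divides them by q is the same in every block, so it should descend to R.
    This needs that the images of the blocks can be lifted to one element of
    R.  On a monomial u of K[Y] whose multidegree is divisible by q this holds
    because modulo the radical u is, up to sign, the q-th power of a monomial
    ([pair_map_root], where q odd is used); all other monomials are killed in
    every block ([sym_perm_split]).

    n = 2: R embeds in K[s,t] as the ring of invariants of (s,t) -> (-s,-t),
    and averaging retracts K[s,t] on R, so that R inherits from K[s,t] maps f
    with f(c) = 1 for any c <> 0 and all large q
    ([strongly_F_regular_sym_perm_quot2]).

    n > 2: R is not a domain.  Let c be the sum of the entries above the
    diagonal; it goes to s t in every block, so it is regular.  For x = y_01
    one has x c = x^2, thus c x^q = x c^q and x is in the tight closure of (c).
    If x = a c, then a is 1 in the block {0,1} and 0 in the block {0,2}, which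
    contradicts the equality of the constant terms of a in the two blocks
    ([not_F_regular_sym_perm_quot]). *)

Set Implicit Arguments.
Unset Strict Implicit.
Unset Printing Implicit Defensive.

Import GRing.Theory.
Local Open Scope ring_scope.

(** * Maps that undo the Frobenius *)

Section CartierMaps.
Variables (A : comNzRingType) (q : nat).

(** The maps that send F_*A linearly to A, where F is the q-th power map. *)
Definition cartier (f : A -> A) : Prop :=
  {morph f : x y / x + y} /\ forall a x, f (a ^+ q * x) = a * f x.

Lemma cartier0 f : cartier f -> f 0 = 0.
Proof. by case=> fD _; apply: (addrI (f 0)); rewrite -fD !addr0. Qed.

(** Writing c r^q = sum a_i g_i^q and applying f gives r = sum f(a_i) g_i. *)
Lemma cartier_ideal f c G r :
  cartier f -> f c = 1 -> frobenius_power G q (c * r ^+ q) -> ideal_gen G r.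
Proof.
move=> [fD fX] fc Gcr; have [J0 JD JM] := ideal_gen_ideal G.
have f0 : f 0 = 0 by apply: cartier0; split.
suff : ideal_gen G (f (1 * (c * r ^+ q))).
  by rewrite mul1r mulrC fX fc mulr1.
move: (c * _) Gcr 1 => x Gx.
suff: [set x | forall y, ideal_gen G (f (y * x))]%classic x by [].
apply: Gx; split; first split=> /=.
- by move=> y; rewrite mulr0 f0.
- by move=> u v Pu Pv y; rewrite mulrDr fD; apply: JD.
- by move=> a u Pu y; rewrite mulrA.
- move=> _ [g Gg <-] y; rewrite mulrC fX mulrC; apply: JM.
  exact: sub_gen_smallest.
Qed.

End CartierMaps.

Lemma pchar_pnat (A : nzSemiRingType) p e :
  p \in [pchar A] -> [pchar A].-nat (p ^ e)%N.
Proof. by move=> chA; rewrite pnatX (pnatE _ (pcharf_prime chA)) chA. Qed.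

Lemma expn_pchar_gt0 (A : nzSemiRingType) p e :
  p \in [pchar A] -> (0 < p ^ e)%N.
Proof. by move=> chA; rewrite expn_gt0 prime_gt0 ?(pcharf_prime chA). Qed.

(** K^q is a direct summand of K as a vector space over K^q.  A subspace V
    maximal among those without 1 (Zorn) satisfies K = V + K^q, and f is the
    projection along V followed by the q-th root. *)
Lemma field_cartier (K : fieldType) p e : p \in [pchar K] ->
  exists2 f : K -> K, cartier (p ^ e) f & f 1 = 1.
Proof.
move=> chK; have nq := pchar_pnat e chK; have q_gt0 := expn_pchar_gt0 e chK.
move: (p ^ e)%N nq q_gt0 => q nq q_gt0.
have qD (x y : K) : (x + y) ^+ q = x ^+ q + y ^+ q by apply: exprDn_pchar.
have q0 : (0 : K) ^+ q = 0 by rewrite expr0n gtn_eqF.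
have qN (x : K) : (- x) ^+ q = - x ^+ q.
  by apply/eqP; rewrite -addr_eq0 -qD addNr q0.
pose P (V : set K) := [/\ forall x y, V x -> V y -> V (x + y),
  forall c x, V x -> V (c ^+ q * x) & ~ V 1].
have [F FP Ftot|V [[VD VM V1] Vmax]] := @Zorn_bigcup K P.
  split=> [x y [X FX Xx] [Y FY Yy]|c x [X FX Xx]|[X /FP[_ _ X1] //]].
    have [le_XY|le_YX] := Ftot _ _ FX FY.
      by exists Y => //; case: (FP _ FY) => + _ _; apply=> //; apply: le_XY.
    by exists X => //; case: (FP _ FX) => + _ _; apply=> //; apply: le_YX.
  by exists X => //; case: (FP _ FX) => _ + _; apply.
(* The empty set satisfies P, hence the case distinction by maximality. *)
have V0 : V 0.
  apply: contrapT => nV0; apply: (Vmax (V `|` [set 0])%classic).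
    by split=> [x|/(_ 0 (or_intror erefl))]; [left|].
  split=> [x y [Vx|->] [Vy|->]|c x [Vx|->]|[//|/eqP]].
  - by left; apply: VD.
  - by left; rewrite addr0.
  - by left; rewrite add0r.
  - by right; rewrite addr0.
  - by left; apply: VM.
  - by right; rewrite mulr0.
  - by rewrite oner_eq0.
have VN x : V x -> V (- x).
  by move=> Vx; rewrite -mulN1r -[1](expr1n _ q) -qN; apply: VM.
(* If x is not in V, then V + K^q x contains 1 by maximality. *)
have decomp x : exists c, V (x - c ^+ q).
  have [Vx|nVx] := pselect (V x); first by exists 0; rewrite q0 subr0.
  have [a Va [c e1]] :
      (exists2 a, V a & exists c, 1 = a + c ^+ q * x).
    apply: contrapT => nex.
    apply: (Vmax [set y | exists2 a, V a & exists c, y = a + c ^+ q * x]%classic).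
      split=> [y Vy|/(_ x)]; first by exists y => //; exists 0; rewrite q0 mul0r addr0.
      move=> sub; apply: nVx; apply: sub.
      by exists 0 => //; exists 1; rewrite expr1n mul1r add0r.
    split=> [y z [a Va [c ->]] [b Vb [d ->]]|c y [a Va [d ->]]|//].
      exists (a + b); first exact: VD.
      by exists (c + d); rewrite qD mulrDl addrACA.
    exists (c ^+ q * a); first exact: VM.
    by exists (c * d); rewrite exprMn mulrDr mulrA.
  have c_neq0 : c != 0.
    by apply: contra_notN V1 => /eqP c0; rewrite e1 c0 q0 mul0r addr0.
  exists c^-1; suff -> : x - c^-1 ^+ q = (c^-1) ^+ q * - a by apply/VM/VN.
  rewrite exprVn mulrN; apply: (canLR (addrK _)); apply: (mulfI (expf_neq0 q c_neq0)).
  rewrite mulrDr mulrN mulrA divff ?expf_neq0 // mul1r; apply/eqP.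
  by rewrite addrC eq_sym subr_eq addrC -e1.
have [f Vf] := choice decomp.
(* If V contained c^q - d^q = (c - d)^q with c <> d, it would contain 1. *)
have f_uniq x c : V (x - c ^+ q) -> f x = c.
  move=> Vc; apply/eqP; rewrite -subr_eq0; apply/negPn/negP => neq0.
  apply: V1; rewrite -(mulVf (expf_neq0 q neq0)) -exprVn; apply: VM.
  by rewrite qD qN -(subrKA x) -opprB; apply: VD => //; apply/VN.
exists f; last by apply: f_uniq; rewrite expr1n subrr.
split=> [x y|a x]; apply: f_uniq.
  by rewrite qD opprD addrACA; apply: VD.
by rewrite exprMn -mulrBr; apply: VM.
Qed.

Section PolyCartier.
Variables (A : comNzRingType) (q a0 : nat) (f : A -> A).
Hypotheses (nq : [pchar A].-nat q) (lt_a0 : (a0 < q)%N) (Cf : cartier q f).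

(** Extends f by X^(a0 + q i) |-> X^i, killing the other residue classes of
    exponents; the twist by a0 serves to send a prescribed polynomial to 1. *)
Definition poly_cartier (u : {poly A}) : {poly A} :=
  \poly_(i < size u) f u`_(a0 + q * i).

Lemma coef_poly_cartier u i : (poly_cartier u)`_i = f u`_(a0 + q * i).
Proof.
rewrite coef_poly; case: ltnP => // le_ui; rewrite nth_default ?(cartier0 Cf) //.
apply: leq_trans le_ui _; rewrite -[leqLHS]mul1n; apply: leq_trans (leq_addl _ _).
by rewrite leq_mul2r (leq_trans _ lt_a0) ?orbT.
Qed.

Lemma poly_cartierP : cartier q poly_cartier.
Proof.
have [fD fX] := Cf.
have tD : {morph poly_cartier : u v / u + v}.
  by move=> u v; apply/polyP => i; rewrite coefD !coef_poly_cartier coefD fD.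
have nq' : [pchar {poly A}].-nat q.
  apply: sub_in_pnat nq => p _; exact: (rmorph_pchar polyC).
split=> // a; elim/poly_ind: a => [|a c IHa] u.
  rewrite expr0n gtn_eqF ?(leq_ltn_trans _ lt_a0) // !mul0r.
  by apply: (addrI (poly_cartier 0)); rewrite -tD !addr0.
rewrite exprDn_pchar // mulrDl tD mulrDl; congr (_ + _).
  rewrite exprMn -mulrA IHa -mulrA; congr (_ * _); apply/polyP=> i.
  rewrite coef_poly_cartier coefXnM coefXM.
  case: i => [|i]; first by rewrite muln0 addn0 lt_a0 (cartier0 Cf).
  by rewrite mulnS addnCA ltnNge leq_addr /= addKn coef_poly_cartier.
apply/polyP => i; rewrite -polyC_exp coef_poly_cartier !coefCM fX.
by rewrite coef_poly_cartier.
Qed.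

End PolyCartier.

Lemma poly_cartier_monom (A : comNzRingType) q f (a : A) i :
  (0 < q)%N -> cartier q f ->
  poly_cartier q 0 f (a%:P * 'X^i) =
    if (q %| i)%N then (f a)%:P * 'X^(i %/ q) else 0.
Proof.
move=> q_gt0 Cf; apply/polyP => j.
rewrite coef_poly_cartier // coefCM coefXn add0n.
case: (boolP (q %| i)%N) => [/dvdnP[k ->]|ndvd].
  rewrite mulnK // coefCM coefXn mulnC eqn_pmul2r //.
  by case: eqP => _; rewrite ?mulr1 ?mulr0 ?(cartier0 Cf).
rewrite coef0; case: eqP => [e|_]; last by rewrite mulr0 (cartier0 Cf).
by rewrite -e dvdn_mulr in ndvd.
Qed.

(** Strong F-regularity, for a domain.  The map is asked for at all large
    exponents, as this is where tight closure gives information. *)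
Definition strongly_F_regular p (A : comNzRingType) : Prop :=
  forall c : A, c != 0 -> exists N, forall e, (N <= e)%N ->
    exists2 f : A -> A, cartier (p ^ e) f & f c = 1.

Lemma field_strongly_F_regular (K : fieldType) p :
  p \in [pchar K] -> strongly_F_regular p K.
Proof.
move=> chK c c0; exists 0%N => e _; have [f [fD fX] f1] := field_cartier e chK.
exists (fun x => f (c^-1 * x)); last by rewrite mulVf.
by split=> [x y|a x]; rewrite ?mulrDr ?fD // mulrCA fX.
Qed.

(** Once q exceeds the degree of c, the residue class modulo q of that degree
    meets c in its leading term only, so a map sending lead_coef c to 1 extends
    to one sending c to 1. *)
Lemma poly_strongly_F_regular (A : comNzRingType) p : p \in [pchar A] ->
  strongly_F_regular p A -> strongly_F_regular p {poly A}.
Proof.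
move=> chA regA c c0; have [|N lcN] := regA (lead_coef c).
  by rewrite lead_coef_eq0.
exists (maxn N (size c)) => e; rewrite geq_max => /andP[leNe le_ce].
have [f Cf f1] := lcN e leNe.
have lt_cq : (size c < p ^ e)%N.
  by rewrite (leq_ltn_trans le_ce) // ltn_expl // prime_gt1 // (pcharf_prime chA).
have lt_cq1 : ((size c).-1 < p ^ e)%N by rewrite (leq_ltn_trans (leq_pred _)).
exists (poly_cartier (p ^ e) (size c).-1 f).
  by apply: poly_cartierP => //; apply: pchar_pnat.
apply/polyP => -[|i]; rewrite coef_poly_cartier // coef1.
  by rewrite muln0 addn0 -lead_coefE f1.
rewrite nth_default ?(cartier0 Cf) // mulnS addnCA.
exact: leq_trans (ltnW lt_cq) (leq_addr _ _).
Qed.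

(** * Criteria for purity and regularity *)

(** A subring R of a product of copies of D inherits a map g of D as soon as the
    values of g in the different factors lift to R simultaneously.  The map g
    need only be linear over q-th powers of elements of R: averages over a
    group have this weaker property. *)
Lemma lift_cartier (R D : comNzRingType) (I : Type)
    (phi : I -> {rmorphism R -> D}) q (g : D -> D) :
    (forall u, (forall i, phi i u = 0) -> u = 0) ->
    {morph g : x y / x + y} ->
    (forall i a x, g (phi i a ^+ q * x) = phi i a * g x) ->
    (forall u, exists v, forall i, phi i v = g (phi i u)) ->
  exists2 f : R -> R, cartier q f & forall i u, phi i (f u) = g (phi i u).
Proof.
move=> phi_inj gD gX /choice[f fP]; exists f => //.
have phiI u v : (forall i, phi i u = phi i v) -> u = v.
  move=> uv; apply/eqP; rewrite -subr_eq0; apply/eqP/phi_inj => i.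
  by rewrite rmorphB uv subrr.
split=> [x y|a x]; apply: phiI => i.
  by rewrite rmorphD !fP rmorphD gD.
by rewrite rmorphM !fP rmorphM rmorphXn gX.
Qed.

Section Closures.
Variables (p : nat) (R : comNzRingType).
Hypothesis chR : p \in [pchar R].
Implicit Types G : set R.

Lemma frobenius_power_exp G e r :
  ideal_gen G r -> frobenius_power G (p ^ e) (r ^+ (p ^ e)).
Proof.
move=> Gr; rewrite -(frobenius_power_ideal_gen G e chR).
by apply: sub_gen_smallest; exists r.
Qed.

Lemma F_pure_cartier :
  (forall e, exists2 f : R -> R, cartier (p ^ e) f & f 1 = 1) -> F_pure p R.
Proof.
move=> split_e G; apply/seteqP; split=> r; first by exists 1%N => //; apply: frobenius_power_exp.
case=> e _ Gr; have [f Cf f1] := split_e e.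
by apply: (cartier_ideal Cf f1); rewrite mul1r.
Qed.

Lemma F_regular_of_strongly : strongly_F_regular p R -> F_regular p R.
Proof.
move=> regR G; apply/seteqP; split=> r.
  move=> Gr; exists 1; first exact: lreg1.
  by exists 0%N => e _; rewrite mul1r; apply: frobenius_power_exp.
case=> c lreg_c [e0 Gr].
have [|N cN] := regR c.
  apply: contraTneq (oner_neq0 R) => c0; apply/negPn/eqP/lreg_c.
  by rewrite c0 !mul0r.
have [f Cf fc] := cN _ (leq_maxr e0 N).
by apply: (cartier_ideal Cf fc); apply: Gr; apply: leq_maxl.
Qed.

End Closures.

(** * Ideals and polynomials *)

(** Induction on s: if c' := c x_i is fixed for a generator x_i of the i-th
    ideal, the claim for c' says that c x_i u^(size s - 1) is in J; the elements y
    with c y u^(size s - 1) in J form an ideal, so u is one of them. *)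
Lemma ideal_prod_mem (R : comNzRingType) (I : eqType) (J : set R) (A : I -> set R)
    (s : seq I) (c u : R) : is_ideal J -> uniq s ->
    (forall i, i \in s -> ideal_gen (A i) u) ->
    (forall x : I -> R, (forall i, i \in s -> A i (x i)) -> J (c * \prod_(i <- s) x i)) ->
  J (c * u ^+ size s).
Proof.
move=> Jid; have [J0 JD JM] := Jid.
elim: s c => [|i s IHs] c /=.
  move=> _ _ /(_ (fun=> 0)); rewrite big_nil expr0; exact.
case/andP=> nis us uA Jx; rewrite exprSr mulrA.
suff: [set y | J (c * u ^+ size s * y)]%classic u by [].
apply: (uA _ (mem_head _ _)); split; first split=> /=.
- by rewrite mulr0.
- by move=> x y Jx' Jy; rewrite mulrDr; apply: JD.
- by move=> a x Jx'; rewrite mulrCA; apply: JM.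
move=> y Ay /=; rewrite mulrAC; apply: IHs => // [j js|x Ax].
  by apply: uA; rewrite inE js orbT.
have := Jx (fun j => if j == i then y else x j).
rewrite big_cons eqxx mulrA.
rewrite (@eq_big_seq _ _ _ _ _ _ (fun j => x j)) => [|j js]; last first.
  by rewrite ifN //; apply: contraNneq nis => <-.
apply=> j; rewrite inE; case: eqP => [-> //|_] /=; exact: Ax.
Qed.

Lemma ideal_subX (R : comNzRingType) (J : set R) (a b : R) c : is_ideal J ->
  J (a - b) -> J (a ^+ c - b ^+ c).
Proof. by move=> [_ _ JM] Jab; rewrite subrXX mulrC; apply: JM. Qed.

Lemma radical_exp (R : comNzRingType) (I : set R) u m :
  radical I (u ^+ m) -> radical I u.
Proof. by case=> r; rewrite -exprM; exists (m * r)%N. Qed.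

(** A repetition of factors in t is harmless, since a power of the product over
    s is divisible by the product over t. *)
Lemma radical_prod (R : comNzRingType) (J : eqType) (I : set R) (x : J -> R) (s t : seq J) :
    is_ideal I -> {subset t <= s} -> radical I (\prod_(i <- t) x i) ->
  radical I (\prod_(i <- s) x i).
Proof.
move=> /radical_ideal[_ _ RM] ts It; apply: (@radical_exp _ _ _ (size t)).
suff [r ->] : exists r, (\prod_(i <- s) x i) ^+ size t = r * \prod_(i <- t) x i.
  exact: RM.
elim: t ts {It} => [|i t IHt] ts; first by exists 1; rewrite big_nil mulr1.
have [|r er] := IHt; first by move=> j jt; rewrite ts // inE jt orbT.
exists (r * \prod_(j <- rem i s) x j); rewrite exprSr er big_cons.
by rewrite [\prod_(j <- s) x j](big_rem i) ?ts ?mem_head //=; ring.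
Qed.

Lemma mpoly_ring_ind (R : comNzRingType) n (P : {mpoly R[n]} -> Prop) :
    (forall c, P c%:MP) -> (forall i, P 'X_i) ->
    (forall u v, P u -> P v -> P (u + v)) ->
    (forall u v, P u -> P v -> P (u * v)) ->
  forall u, P u.
Proof.
move=> PC PX PD PM u; rewrite (mpolyE u).
apply: big_ind => [||m _]; [by rewrite -mpolyC0|exact: PD|].
rewrite -mul_mpolyC; apply: (PM) => //; rewrite mpolyXE_id.
apply: big_ind => [||i _]; [by rewrite -mpolyC1|exact: PM|].
elim: (m i) => [|k IHk]; first by rewrite expr0 -mpolyC1.
by rewrite exprS; apply: PM.
Qed.

Section PolySum.
Variables (A : nzRingType) (V : zmodType) (F : nat -> A -> V).
Hypothesis FD : forall i, {morph F i : x y / x + y}.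

(** The additive map on polynomials with given values F i a on a X^i, when
    F i is additive. *)
Definition poly_sum (u : {poly A}) : V := \sum_(i < size u) F i u`_i.

Let F0 i : F i 0 = 0.
Proof. by apply: (addrI (F i 0)); rewrite -FD !addr0. Qed.

Lemma poly_sum_widen (u : {poly A}) N : (size u <= N)%N -> poly_sum u = \sum_(i < N) F i u`_i.
Proof.
move=> le_uN; rewrite /poly_sum (big_ord_widen N (fun i => F i u`_i) le_uN).
rewrite big_mkcond; apply: eq_bigr => i _; case: ltnP => // le_ui.
by rewrite nth_default.
Qed.

Lemma poly_sumD : {morph poly_sum : u v / u + v}.
Proof.
move=> u v; have le_uv := size_polyD u v.
rewrite (poly_sum_widen le_uv) (poly_sum_widen (leq_maxl _ (size v))).
rewrite (poly_sum_widen (leq_maxr (size u) _)) -big_split.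
by apply: eq_bigr => i _; rewrite coefD FD.
Qed.

Lemma poly_sum0 : poly_sum 0 = 0.
Proof. by rewrite /poly_sum size_poly0 big_ord0. Qed.

Lemma poly_sum_monom a i : poly_sum (a%:P * 'X^i) = F i a.
Proof.
have le_sz : (size (a%:P * 'X^i)%R <= i.+1)%N.
  apply: leq_trans (size_polyMleq _ _) _; rewrite size_polyXn addnS /=.
  by rewrite -[i.+1]add1n leq_add2r size_polyC leq_b1.
rewrite (poly_sum_widen le_sz) big_ord_recr /= coefCM coefXn eqxx mulr1.
rewrite big1 ?add0r // => j _; rewrite coefCM coefXn ltn_eqF ?mulr0 ?F0 //.
Qed.
End PolySum.

(** * The map attached to a pair of indices *)

Section Pairs.
Variables (K : fieldType) (n : nat).
Implicit Types i j k l : 'I_n.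
Local Notation S := {mpoly K[#|{: upper_index n}|]}.
Local Notation D := {poly {poly K}}.
Local Notation index := 'I_#|{: upper_index n}|.
Local Notation monom := 'X_{1.. #|{: upper_index n}|}.

Definition sym_var (i j : 'I_n) : index := enum_rank (upper i j).
Local Notation y i j := ('X_(sym_var i j) : S).
Definition row_of (v : index) : 'I_n := (val (enum_val v)).1.
Definition col_of (v : index) : 'I_n := (val (enum_val v)).2.

Lemma upperC (i j : 'I_n) : upper i j = upper j i.
Proof.
apply: val_inj; rewrite /= /sort_pair; case: ltngtP => // e.
by rewrite (val_inj e).
Qed.

Lemma sym_varC i j : sym_var i j = sym_var j i.
Proof. by rewrite /sym_var upperC. Qed.

Lemma sym_varE v : v = sym_var (row_of v) (col_of v).
Proof.
apply: enum_val_inj; rewrite /sym_var enum_rankK; apply: val_inj.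
rewrite /= /sort_pair /row_of /col_of.
by case: (enum_val v) => -[a b] /= ->.
Qed.

Lemma sym_var_ends i j :
  (row_of (sym_var i j), col_of (sym_var i j)) = (i, j) \/
  (row_of (sym_var i j), col_of (sym_var i j)) = (j, i).
Proof.
rewrite /row_of /col_of /sym_var enum_rankK /= /sort_pair.
by case: ifP; [left|right].
Qed.

Lemma sym_var_eq i j i' j' : (sym_var i j == sym_var i' j') =
  ((i == i') && (j == j')) || ((i == j') && (j == i')).
Proof.
apply/eqP/idP => [e|/orP[/andP[/eqP-> /eqP->]//|/andP[/eqP-> /eqP->]]]; last first.
  exact: sym_varC.
have := sym_var_ends i j; rewrite e => -[] [<- <-].
  by have [[-> ->]|[-> ->]] := sym_var_ends i' j'; rewrite !eqxx ?orbT.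
by have [[-> ->]|[-> ->]] := sym_var_ends i' j'; rewrite !eqxx ?orbT.
Qed.

Definition pair_param (k l i : 'I_n) : D :=
  if i == k then 'X else if i == l then ('X)%:P else 0.

Definition pair_entry k l i j : D :=
  (if (i == l) && (j == l) then -1 else 1) * (pair_param k l i * pair_param k l j).

(** The outer variable of {poly {poly K}} is s, the inner one is t.  The sign
    at (l, l) makes the image of y_kk y_ll + y_kl^2 vanish without a square root
    of -1 in K. *)
Definition pair_map k l : S -> D :=
  mmap (polyC \o polyC) (fun v => pair_entry k l (row_of v) (col_of v)).

HB.instance Definition _ k l := GRing.RMorphism.on (pair_map k l).

Lemma pair_mapC k l c : pair_map k l c%:MP = c%:P%:P.
Proof. exact: mmapC. Qed.

Lemma pair_mapZ k l c u : pair_map k l (c *: u) = c%:P%:P * pair_map k l u.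
Proof. exact: mmapZ. Qed.

Lemma pair_map_var k l i j : pair_map k l (y i j) = pair_entry k l i j.
Proof.
rewrite /pair_map mmapX mmap1U /pair_entry.
have [[-> ->] //|[-> ->]] := sym_var_ends i j.
by rewrite andbC [X in _ * X]mulrC.
Qed.

Lemma pair_map_kk k l : k != l -> pair_map k l (y k k) = 'X ^+ 2.
Proof. by move=> kl; rewrite pair_map_var /pair_entry /pair_param (negPf kl) eqxx mul1r. Qed.

Lemma pair_map_ll k l : k != l -> pair_map k l (y l l) = - ('X)%:P ^+ 2.
Proof.
by move=> kl; rewrite pair_map_var /pair_entry /pair_param eq_sym (negPf kl) eqxx mulN1r.
Qed.

Lemma pair_map_kl k l : k != l -> pair_map k l (y k l) = 'X * ('X)%:P.
Proof.
move=> kl; rewrite pair_map_var /pair_entry /pair_param (negPf kl) !eqxx eq_sym.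
by rewrite (negPf kl) mul1r.
Qed.

Definition outside_pair (k l i j : 'I_n) := ~~ ((i \in [:: k; l]) && (j \in [:: k; l])).

Lemma pair_map_out k l i j : outside_pair k l i j -> pair_map k l (y i j) = 0.
Proof.
rewrite /outside_pair !inE pair_map_var /pair_entry /pair_param.
by case: (i == k); case: (j == k); case: (i == l); case: (j == l);
   rewrite //= ?mul0r ?mulr0.
Qed.

Lemma pair_param_mul k l i j : i != j ->
  [\/ pair_param k l i * pair_param k l j = 0,
      i = k /\ j = l | i = l /\ j = k].
Proof.
rewrite /pair_param; have [->|ik] := eqVneq i k; have [->|jk] := eqVneq j k;
  have [?|il] := eqVneq i l; have [?|jl] := eqVneq j l => //; subst;
  rewrite ?eqxx // => _; rewrite ?mul0r ?mulr0;
  by [constructor 1|constructor 2|constructor 3].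
Qed.

(** Both products of the permanent are a_f0 a_f1 a_g0 a_g1 up to
    sign, where a is [pair_param].  If this is nonzero, the rows and the columns
    are both {k, l}, and the sign at (l, l) occurs in exactly one of the
    products. *)
Lemma pair_map_perm k l f0 f1 g0 g1 : k != l -> f0 != f1 -> g0 != g1 ->
  pair_map k l (y f0 g0 * y f1 g1 + y f0 g1 * y f1 g0) = 0.
Proof.
move=> kl f01 g01; rewrite rmorphD !rmorphM /= !pair_map_var /pair_entry.
pose s i j : D := if (i == l) && (j == l) then -1 else 1.
transitivity ((pair_param k l f0 * pair_param k l f1) *
   (pair_param k l g0 * pair_param k l g1) *
   (s f0 g0 * s f1 g1 + s f0 g1 * s f1 g0)).
  by rewrite -/(s _ _) -/(s _ _) -/(s _ _) -/(s _ _); ring.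
rewrite {}/s; case: (pair_param_mul k l f01) => [->|[-> ->]|[-> ->]];
  case: (pair_param_mul k l g01) => [->|[-> ->]|[-> ->]];
  by rewrite ?(negPf kl) ?eqxx /= ?mul0r ?mulr0 ?mul0r // ?(mulr1, mul1r) ?subrr ?addNr mulr0.
Qed.

Definition pair_quadric k l : S := y k k * y l l + y k l ^+ 2.

Definition pair_gens k l : set S :=
  [set u | u = pair_quadric k l \/ exists i j, outside_pair k l i j /\ u = y i j]%classic.

Lemma monom_pairP k l (m : monom) : k != l ->
  (exists i j m', outside_pair k l i j /\ 'X_[m] = y i j * 'X_[m'] :> S) \/
  (m = (U_(sym_var k k) *+ m (sym_var k k) + U_(sym_var l l) *+ m (sym_var l l)
         + U_(sym_var k l) *+ m (sym_var k l))%MM).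
Proof.
move=> kl.
have [/existsP[v /andP[vo mv]]|/existsPn in_m] :=
  boolP [exists v, outside_pair k l (row_of v) (col_of v) && (0 < m v)%N].
  left; exists (row_of v), (col_of v), (m - U_(v))%MM; split=> //.
  by rewrite -sym_varE -mpolyXD addmC submK // lep1mP -lt0n.
right; apply/mnmP => v; rewrite !mnmDE !mulmnE !mnm1E !(eq_sym _ v).
have := in_m v; rewrite negb_and negbK -eqn0Ngt.
case/orP=> [|/eqP mv]; last first.
  have zero v' : ((v == v') * m v' = 0)%N by case: eqP => [<-|//]; rewrite mv.
  by rewrite mv !zero.
move: (row_of v) (col_of v) (sym_varE v) => i j ->; rewrite !sym_var_eq.
have lk : (l == k) = false by rewrite eq_sym; apply: negPf.
rewrite !inE => /andP[/orP[]/eqP-> /orP[]/eqP->];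
  rewrite ?eqxx ?(negPf kl) ?lk /= ?(muln0, muln1, mul0n, mul1n, addn0, add0n) //.
by rewrite sym_varC.
Qed.

End Pairs.

(** * The kernel of the map attached to a pair *)

Section Pairs.
Variables (K : fieldType) (n : nat).
Implicit Types i j k l : 'I_n.
Local Notation S := {mpoly K[#|{: upper_index n}|]}.
Local Notation D := {poly {poly K}}.
Local Notation monom := 'X_{1.. #|{: upper_index n}|}.
Local Notation y i j := ('X_(sym_var i j) : S).

Definition torus_monom (i j : nat) : D := ('X^j)%:P * 'X^i.

Definition pair_monom k l a b c : S := y k k ^+ a * y l l ^+ b * y k l ^+ c.

Lemma monom_pairE k l (m : monom) : k != l ->
  (exists i j m', outside_pair k l i j /\ 'X_[m] = y i j * 'X_[m'] :> S) \/
  'X_[m] = pair_monom k l (m (sym_var k k)) (m (sym_var l l)) (m (sym_var k l)).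
Proof.
move=> kl; have [|e] := @monom_pairP K n k l m kl; [by left|right].
by rewrite {1}e !mpolyXD -!mpolyXn.
Qed.

Lemma pair_map_monom k l a b c : k != l ->
  pair_map k l (pair_monom k l a b c) =
    (-1) ^+ b * torus_monom (a.*2 + c) (b.*2 + c).
Proof.
move=> kl; rewrite !rmorphM /= !rmorphXn /= pair_map_kk // pair_map_ll //.
rewrite pair_map_kl // /torus_monom !polyC_exp (exprNn (_ ^+ 2)) (exprMn c).
rewrite -!muln2 (exprD _ _ c) (exprD _ _ c) !exprM (exprAC 'X) (exprAC 'X%:P).
ring.
Qed.

Definition pair_section_monom k l (i j : nat) : S :=
  y k l ^+ odd i * y k k ^+ i./2 * (- y l l) ^+ j./2.

(** An additive section of [pair_map] on its image: s^i t^j with i and j of the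
    same parity goes to the monomial above it that has y_kl at most once.  The
    image contains no other monomials. *)
Definition pair_section k l : D -> S :=
  poly_sum (fun i : nat => poly_sum (fun (j : nat) c => c *: pair_section_monom k l i j)).

Lemma pair_sectionD k l : {morph pair_section k l : u v / u + v}.
Proof.
apply: poly_sumD => i; apply: poly_sumD => j a b; exact: scalerDl.
Qed.

Lemma pair_section_torus k l c (i j : nat) :
  pair_section k l (c%:P%:P * torus_monom i j) = c *: pair_section_monom k l i j.
Proof.
rewrite /torus_monom mulrA -polyCM /pair_section !poly_sum_monom // => *; first exact: scalerDl.
apply: poly_sumD => *; exact: scalerDl.
Qed.

(** Modulo the generators, y_kl^2 = - y_kk y_ll brings each monomial in the block
    to the form used by [pair_section]. *)
Lemma pair_section_map k l u : k != l ->
  ideal_gen (pair_gens k l) (u - pair_section k l (pair_map k l u)).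
Proof.
move=> kl; have Jid := ideal_gen_ideal (pair_gens k l : set S).
have [J0 JD JM] := Jid.
elim/mpolyind: u => [|c m u _ _ IHu].
  by rewrite rmorph0 /pair_section poly_sum0 subrr.
rewrite rmorphD /= pair_sectionD opprD addrACA; apply: JD => // {u IHu}.
rewrite pair_mapZ; have [[i [j [m' [out ->]]]]|->] := monom_pairE m kl.
  rewrite rmorphM /= pair_map_out // mul0r mulr0 /pair_section poly_sum0 subr0.
  rewrite -mul_mpolyC mulrCA mulrC; apply: (JM); apply: sub_gen_smallest.
  by right; exists i, j.
move: (m _) (m _) (m _) => c' b a; rewrite pair_map_monom //.
have -> : (-1) ^+ b = ((-1) ^+ b : K)%:P%:P :> D by rewrite !rmorphXn !rmorphN1.
rewrite mulrA -!polyCM pair_section_torus -scalerA -scalerBr -mul_mpolyC; apply: (JM).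
rewrite /pair_section_monom !halfD !oddD !odd_double /= !doubleK !add0n -mul_mpolyC.
rewrite rmorphXn rmorphN1.
suff -> : pair_monom k l a b c' - (-1) ^+ b * (y k l ^+ odd c' *
    y k k ^+ (a + c'./2) * (- y l l) ^+ (b + c'./2)) =
    y k k ^+ a * y l l ^+ b * y k l ^+ odd c' *
    ((y k l ^+ 2) ^+ c'./2 - (- (y k k * y l l)) ^+ c'./2).
  apply: JM; apply: (ideal_subX _ Jid); apply: sub_gen_smallest; left.
  by rewrite opprK addrC.
rewrite /pair_monom -{1}[c'](odd_double_half c') -muln2 [(_ * 2)%N]mulnC.
rewrite (exprNn _ (b + _)) (exprNn _ c'./2) (exprMn c'./2 (y k k)) (exprD _ (odd c')) exprM
  (exprD _ a) (exprD _ b) (exprD _ b).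
have := signrMK b (1 : S); rewrite mulr1.
by move: ((-1) ^+ b) => sg sg2; ring: sg2.
Qed.
End Pairs.

(** * The radical of the permanental ideal *)

Section Pairs.
Variables (K : fieldType) (n : nat).
Implicit Types i j k l : 'I_n.
Local Notation S := {mpoly K[#|{: upper_index n}|]}.
Local Notation y i j := ('X_(sym_var i j) : S).
Local Notation P := (P2 (sym_mx K n)).

Lemma pair_map_ker k l (u : S) : k != l -> pair_map k l u = 0 ->
  ideal_gen (pair_gens k l) u.
Proof.
move=> kl u0; have := pair_section_map u kl.
by rewrite u0 /pair_section poly_sum0 subr0.
Qed.

Lemma P2_perm f0 f1 g0 g1 : f0 != f1 -> g0 != g1 ->
  P (y f0 g0 * y f1 g1 + y f0 g1 * y f1 g0).
Proof.
move=> f01 g01; apply: sub_gen_smallest.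
pose pr (a b : 'I_n) (i : 'I_2) := if i == ord0 then a else b.
have pr_inj a b : a != b -> injective (pr a b).
  move=> ab i j; rewrite /pr; case: eqP => [->|i0]; case: eqP => [->|j0] // e.
  - by rewrite e eqxx in ab.
  - by rewrite e eqxx in ab.
  - apply: val_inj; case: i i0 {e} => -[|[|//]] /= ? i0; first by case: i0; apply: val_inj.
    by case: j j0 => -[|[|//]] /= ? j0 //; case: j0; apply: val_inj.
exists (pr f0 f1), (pr g0 g1); split; [exact: pr_inj|exact: pr_inj|].
by rewrite /permanent2 !mxE /pr.
Qed.

Lemma P2_quadric k l : k != l -> P (pair_quadric K k l).
Proof.
by move=> kl; have := P2_perm kl kl; rewrite (sym_varC l k) -expr2.
Qed.

Lemma pair_map_P2 k l u : k != l -> radical P u -> pair_map k l u = 0.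
Proof.
move=> kl [m Pu]; suff : pair_map k l (u ^+ m) = 0.
  by rewrite rmorphXn => /eqP; rewrite expf_eq0 => /andP[_ /eqP].
suff: [set v | pair_map k l v = 0]%classic (u ^+ m) by [].
apply: Pu; split; first split=> /=.
- exact: rmorph0.
- by move=> v w v0 w0; rewrite rmorphD /= v0 w0 addr0.
- by move=> v w w0; rewrite rmorphM /= w0 mulr0.
move=> _ [f] [g] [f_inj g_inj ->] /=; rewrite /permanent2 !mxE.
by apply: pair_map_perm => //; rewrite inj_eq.
Qed.

Hypothesis two_neq0 : 2%:R != 0 :> K.
Local Notation J := (radical P).
Let Pid : is_ideal P := ideal_gen_ideal _.
Let Jid : is_ideal J := radical_ideal Pid.

Let P_half (u : S) : P (u *+ 2) -> P u.
Proof.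
case: Pid => _ _ PM /(PM (2%:R^-1)%:MP); congr (P _).
by rewrite mulrnAr -mulrnAl -rmorphMn -mulr_natr mulVf // rmorph1 mul1r.
Qed.

Let P_sub_J u : P u -> J u.
Proof. by exists 1%N. Qed.

(** Let x, z, w be the entries at ij, ik, jk and A, B, C those on the diagonal.
    Then x^2 z^2 = (-AB)(-AC) by two quadrics, while x z = -A w and
    w^2 = -BC give x^2 z^2 = -A^2 B C; so 2 x^2 z^2 is in P_2. *)
Lemma rad_P2_triangle i j k : i != j -> i != k -> j != k -> J (y i j * y i k).
Proof.
move=> ij ik jk; case: Pid => P0 PD PM.
exists 2%N; apply: P_half.
have := P2_quadric ij; have := P2_quadric ik; have := P2_quadric jk.
have := P2_perm ij ik; rewrite /pair_quadric (sym_varC j i).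
move: (y i i) (y j j) (y k k) (y i j) (y i k) (y j k) => A B C x z w.
move=> Pa Pjk Pik Pij.
suff -> : (x * z) ^+ 2 *+ 2 = z ^+ 2 * (A * B + x ^+ 2) + - (A * B) * (A * C + z ^+ 2)
    + ((x * z - A * w) * (A * w + z * x) + A ^+ 2 * (B * C + w ^+ 2)).
  by apply: (PD); [apply: (PD)|]; [exact: PM|exact: PM|by apply: (PD); exact: PM].
by ring.
Qed.

(** The products of the three perfect matchings of {i, j, k, l} have pairwise
    sums in P_2. *)
Lemma rad_P2_disjoint i j k l : uniq [:: i; j; k; l] -> J (y i j * y k l).
Proof.
rewrite /= !inE !negb_or -!andbA => /and5P[ij ik il jk /and3P[jl kl _]].
case: Pid => P0 PD PM; apply: P_sub_J; apply: P_half.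
have := PM (-1) _ (P2_perm ij kl); have := P2_perm ik jl.
have := P2_perm il jk.
rewrite (sym_varC l k) (sym_varC k j) (sym_varC l j) => P1 P2' P3.
have := PD _ _ P1 (PD _ _ P2' P3); congr (P _); ring.
Qed.

(** By the number of distinct indices.  With four of them the entries are disjoint;
    with three, either they share one index, or the product is y_ab y_cc, which is
    - y_ca y_cb modulo a permanent. *)
Lemma rad_P2_outside i j k l : i != j -> outside_pair i j k l -> J (y i j * y k l).
Proof.
have [J0 JD JM] := Jid.
wlog kout : k l / k \notin [:: i; j] => [IH ij|].
  rewrite /outside_pair negb_and => /orP[] out.
    by apply: IH; rewrite // /outside_pair negb_and out.
  by rewrite (sym_varC k); apply: IH; rewrite // /outside_pair negb_and out.
move=> ij _; move: kout; rewrite !inE negb_or => /andP[ki kj].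
have tri (a b c : 'I_n) : a != b -> a != c -> b != c -> J (y a b * y c c).
  move=> ab ac bc; have ca : c != a by rewrite eq_sym.
  have cb : c != b by rewrite eq_sym.
  have Jp : J (y c c * y a b + y c b * y a c) by exact: P_sub_J (P2_perm ca cb).
  have Jt := rad_P2_triangle ca cb ab; have := JD _ _ Jp (JM (-1) _ Jt).
  by rewrite (sym_varC a c); congr (J _); ring.
have ik : i != k by rewrite eq_sym.
have jk : j != k by rewrite eq_sym.
have [->|li] := eqVneq l i.
  by rewrite (sym_varC k i); apply: rad_P2_triangle.
have [->|lj] := eqVneq l j.
  by rewrite (sym_varC k j) (sym_varC i j); apply: rad_P2_triangle; rewrite // eq_sym.
have [->|lk] := eqVneq l k; first exact: tri.
by apply: rad_P2_disjoint; rewrite /= !inE !negb_or ij ik (eq_sym i) li jk (eq_sym j) lj eq_sym lk.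
Qed.

(** y_ii y_jj = - y_ij^2 reduces to a product of entries not in a common block. *)
Lemma rad_P2_diag3 i j k : i != j -> i != k -> j != k -> J (y i i * (y j j * y k k)).
Proof.
have [J0 JD JM] := Jid => ij ik jk.
have out : outside_pair i j k k.
  by rewrite /outside_pair !inE ![k == _]eq_sym (negPf ik) (negPf jk).
have := JD _ _ (JM (y k k) _ (P_sub_J (P2_quadric ij)))
               (JM (- y i j) _ (rad_P2_outside ij out)).
by rewrite /pair_quadric; congr (J _); ring.
Qed.

(** It is enough to put in the radical every product of generators of the
    kernels, one for each ordered pair.  Suppose one is not.  Its factors are then
    entries x(k,l) outside the block {k, l}.  An off-diagonal factor y_ij has a
    product in the radical with x(i,j), so all factors are diagonal; from
    x(0,1) = y_ii, x(i,m) = y_jj and x(i,j) = y_kk one gets three distinct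
    ones. *)
Lemma rad_P2E (u : S) : (1 < n)%N ->
  J u <-> forall k l, k != l -> pair_map k l u = 0.
Proof.
move=> n_gt1; split=> [Ju k l kl|u0]; first exact: pair_map_P2.
pose s : seq ('I_n * 'I_n) := [seq p <- enum {: 'I_n * 'I_n} | p.1 != p.2].
have sP k l : ((k, l) \in s) = (k != l) by rewrite mem_filter mem_enum andbT.
apply: (@radical_exp _ _ _ (size s)); rewrite -[_ ^+ _]mul1r.
apply: (@ideal_prod_mem _ _ _ (fun p => pair_gens p.1 p.2)) => //.
- by rewrite filter_uniq ?enum_uniq.
- by move=> [k l]; rewrite sP => kl; apply: pair_map_ker => //; apply: u0.
move=> x xA; rewrite mul1r; apply: contrapT => nJ.
have sub t : {subset t <= s} -> ~ J (\prod_(p <- t) x p).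
  by move=> ts Jt; apply: nJ; apply: radical_prod Jt.
have x_var k l : k != l -> exists i j, outside_pair k l i j /\ x (k, l) = y i j.
  move=> kl; have kls : (k, l) \in s by rewrite sP.
  have [xq|//] := xA _ kls; exfalso; apply: (sub [:: (k, l)]).
    by move=> p; rewrite inE => /eqP->.
  by rewrite big_seq1 xq; exact: P_sub_J (P2_quadric kl).
have x_diag k l : k != l -> exists i, [/\ i != k, i != l & x (k, l) = y i i].
  move=> kl; have [i [j [out xij]]] := x_var k l kl.
  have [eij|ij] := eqVneq i j.
    exists j; rewrite eij in out xij; split=> //; apply: contraNneq out => ->;
    by rewrite !inE eqxx ?orbT.
  have [i' [j' [out' xij']]] := x_var i j ij; exfalso.
  apply: (sub [:: (k, l); (i, j)]).
    by move=> p; rewrite !inE => /orP[]/eqP->; rewrite sP.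
  by rewrite big_cons big_seq1 xij xij'; apply: rad_P2_outside.
have [i [_ _ x1]] := x_diag (Ordinal (ltnW n_gt1)) (Ordinal n_gt1) isT.
have [m im] : exists m, i != m.
  have [e|ne] := eqVneq i (Ordinal n_gt1); last by exists (Ordinal n_gt1).
  by exists (Ordinal (ltnW n_gt1)); rewrite e.
have [j [ji _ x2]] := x_diag i m im.
have ij : i != j by rewrite eq_sym.
have [k [ki kj x3]] := x_diag i j ij.
apply: (sub [:: (Ordinal (ltnW n_gt1), Ordinal n_gt1); (i, m); (i, j)]).
  by move=> p; rewrite !inE => /or3P[]/eqP->; rewrite sP.
by rewrite !big_cons big_nil mulr1 x1 x2 x3; apply: rad_P2_diag3; rewrite // eq_sym.
Qed.
End Pairs.

(** * The quotient ring, and its failure of regularity for n > 2 *)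

Section Quot.
Local Open Scope quotient_scope.
Variables (K : fieldType) (n : nat).
Implicit Types i j k l : 'I_n.
Local Notation S := {mpoly K[#|{: upper_index n}|]}.
Local Notation D := {poly {poly K}}.
Local Notation R := (sym_perm_quot K n).
Local Notation y i j := ('X_(sym_var i j) : S).
Local Notation P := (P2 (sym_mx K n)).

Definition pair_index := {p : 'I_n * 'I_n | p.1 != p.2}.

Definition quot_proj : S -> R := \pi_R.
HB.instance Definition _ := GRing.RMorphism.on quot_proj.

Lemma quot_proj_eq u v : quot_proj u = quot_proj v <-> radical P (u - v).
Proof.
split=> [/eqP|Puv].
  by rewrite -Quotient.idealrBE => /asboolP.
by apply/eqP; rewrite -Quotient.idealrBE; apply/asboolP.
Qed.

Lemma quot_proj_eq0 u : quot_proj u = 0 <-> radical P u.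
Proof. by rewrite -[u in radical _ u]subr0 -quot_proj_eq (rmorph0 quot_proj). Qed.

Lemma quot_proj_surj (x : R) : exists u, x = quot_proj u.
Proof. by exists (repr x); rewrite /quot_proj reprK. Qed.

(** [pair_map] on the quotient; it does not depend on the representative. *)
Definition quot_map (p : pair_index) (x : R) : D :=
  pair_map (val p).1 (val p).2 (repr x).

Lemma quot_map_proj p u : quot_map p (quot_proj u) = pair_map (val p).1 (val p).2 u.
Proof.
apply/eqP; rewrite -subr_eq0 -rmorphB; apply/eqP/(pair_map_P2 (valP p)).
by apply/quot_proj_eq; rewrite /quot_proj reprK.
Qed.

Fact quot_map_zmod p : zmod_morphism (quot_map p).
Proof.
move=> a b; have [u ->] := quot_proj_surj a; have [v ->] := quot_proj_surj b.
rewrite -(rmorphB quot_proj u v) !quot_map_proj; exact: rmorphB.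
Qed.

Fact quot_map_monoid p : monoid_morphism (quot_map p).
Proof.
split=> [|a b]; first by rewrite -(rmorph1 quot_proj) quot_map_proj rmorph1.
have [u ->] := quot_proj_surj a; have [v ->] := quot_proj_surj b.
rewrite -(rmorphM quot_proj u v) !quot_map_proj; exact: rmorphM.
Qed.

HB.instance Definition _ p := GRing.isZmodMorphism.Build R D (quot_map p) (quot_map_zmod p).
HB.instance Definition _ p := GRing.isMonoidMorphism.Build R D (quot_map p) (quot_map_monoid p).

Lemma quot_map_sub p (x z : R) : quot_map p x = quot_map p z -> quot_map p (x - z) = 0.
Proof. by move=> xz; rewrite rmorphB /= xz subrr. Qed.

Lemma quot_map1 p : quot_map p 1 = 1.
Proof. exact: rmorph1. Qed.

Lemma pchar_quot p : p \in [pchar K] -> p \in [pchar R].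
Proof.
by move=> chK; apply: (rmorph_pchar quot_proj); apply: (rmorph_pchar (@mpolyC _ K)).
Qed.

Hypotheses (two_neq0 : 2%:R != 0 :> K) (n_gt1 : (1 < n)%N).

Lemma quot_map_inj x : (forall p, quot_map p x = 0) -> x = 0.
Proof.
have [u ->] := quot_proj_surj x => u0.
apply/quot_proj_eq0/rad_P2E => // k l kl.
exact: etrans (esym (quot_map_proj (exist _ (k, l) kl) u)) (u0 _).
Qed.

Lemma quot_map_eq x z : (forall p, quot_map p x = quot_map p z) -> x = z.
Proof.
move=> xz; apply/eqP; rewrite -subr_eq0; apply/eqP/quot_map_inj => p.
exact: quot_map_sub.
Qed.

(** The blocks are glued at the origin: two values of one element at the origin
    cannot differ, which is what keeps x out of (c) below. *)
Lemma pair_map_const k l (u : S) : (pair_map k l u).[0].[0] = u.@[fun=> 0].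
Proof.
elim/mpoly_ring_ind: u => [c|i|u v IHu IHv|u v IHu IHv].
- by rewrite pair_mapC !hornerC mevalC.
- have param0 j : (pair_param K k l j).[0].[0] = 0.
    by rewrite /pair_param; do 2?[case: ifP => _]; rewrite !hornerE.
  by rewrite mevalXU (sym_varE i) pair_map_var /pair_entry !hornerM param0 mul0r mulr0.
- by rewrite !rmorphD /= !hornerD IHu IHv.
- by rewrite !rmorphM /= !hornerM IHu IHv.
Qed.

(** x = y_01 is in the tight closure of (c) but not in (c), where c is the sum
    of the off-diagonal entries: c and x agree in the block {0, 1}, and x
    vanishes in the others. *)
Lemma not_F_regular_sym_perm_quot p : p \in [pchar K] -> (2 < n)%N -> ~ F_regular p R.
Proof.
move=> chK n_gt2 regR.
pose i0 : 'I_n := Ordinal (ltnW n_gt1); pose i1 : 'I_n := Ordinal n_gt1.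
pose i2 : 'I_n := Ordinal n_gt2.
pose cS : S := \sum_(v | row_of v != col_of v) 'X_v.
have cE k l : k != l -> pair_map k l cS = 'X * 'X%:P.
  move=> kl; have nkl : row_of (sym_var k l) != col_of (sym_var k l).
    by have [[-> ->]|[-> ->]] := sym_var_ends k l; rewrite // eq_sym.
  rewrite rmorph_sum (bigD1 (sym_var k l)) //= pair_map_kl // big1 ?addr0 //.
  move=> v; move: (row_of v) (col_of v) (sym_varE v) => i j ->.
  rewrite sym_var_eq => ijkl; apply: pair_map_out.
  move: ijkl; rewrite /outside_pair !inE.
  have [->|ik] := eqVneq i k; have [->|jk] := eqVneq j k;
  have [e|il] := eqVneq i l; have [e'|jl] := eqVneq j l;
    by subst; rewrite ?eqxx ?andbF //=.
pose c := quot_proj cS; pose x := quot_proj (y i0 i1).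
have xc p0 : quot_map p0 x = 0 \/ quot_map p0 x = quot_map p0 c.
  rewrite !quot_map_proj; case: p0 => -[k l] /= kl; rewrite cE //.
  have [|in_kl] := boolP (outside_pair k l i0 i1); first by left; apply: pair_map_out.
  right; rewrite -(pair_map_kl _ kl); congr (pair_map _ _ 'X_ _); apply/eqP.
  rewrite sym_var_eq; move: in_kl; rewrite /outside_pair negbK !inE.
  have i01 : i0 != i1 by [].
  case/andP=> /orP[]/eqP e0 /orP[]/eqP e1; rewrite e0 e1 ?eqxx ?orbT //;
  by rewrite e0 e1 eqxx in i01.
have lreg_c : GRing.lreg c.
  move=> a b ab; apply: quot_map_eq => p0; apply: (@mulfI _ (quot_map p0 c)).
    by rewrite quot_map_proj cE ?mulf_neq0 ?polyX_eq0 ?polyC_eq0 ?polyX_eq0 //; case: p0.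
  by rewrite -!rmorphM; congr quot_map.
have : tight_closure p [set c]%classic x.
  exists c => //; exists 0%N => e _.
  have -> : c * x ^+ (p ^ e) = x * c ^+ (p ^ e).
    apply: quot_map_eq => p0; rewrite !rmorphM !rmorphXn /=.
    have q_gt0 := expn_pchar_gt0 e chK.
    have [->|->] := xc p0; last by [].
    by rewrite expr0n gtn_eqF // mulr0 mul0r.
  have [_ _ JM] := ideal_gen_ideal [set g ^+ (p ^ e) | g in [set c]]%classic.
  by apply: JM; apply: sub_gen_smallest; exists c.
rewrite -regR => /(_ [set z | exists a, z = a * c]%classic) [].
  split=> [|z]; last by move=> ->; exists 1; rewrite mul1r.
  split=> [|z z' [a ->] [b ->]|a z [b ->]].
  - by exists 0; rewrite mul0r.
  - by exists (a + b); rewrite mulrDl.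
  - by exists (a * b); rewrite mulrA.
move=> a; have [u ->] := quot_proj_surj a => e.
have st0 : 'X * ('X)%:P != 0 :> D by rewrite mulf_neq0 ?polyX_eq0 ?polyC_eq0 ?polyX_eq0.
have := congr1 (quot_map (exist _ (i0, i1) isT)) e.
rewrite rmorphM /= /x /c !quot_map_proj /= cE // pair_map_kl // => /esym e1.
have := congr1 (quot_map (exist _ (i0, i2) isT)) e.
rewrite rmorphM /= /x /c !quot_map_proj /= cE // pair_map_out // => /esym e2.
have u1 : pair_map i0 i1 u = 1 by apply: (mulIf st0); rewrite mul1r.
have u2 : pair_map i0 i2 u = 0 by apply: (mulIf st0); rewrite mul0r.
have := pair_map_const i0 i1 u; rewrite -(pair_map_const i0 i2) u1 u2 !hornerE.
by move/eqP; rewrite oner_eq0.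
Qed.
End Quot.

(** * Regularity for n = 2 *)

Section Torus.
Variable K : fieldType.
Local Notation D := {poly {poly K}}.

Lemma torus_ind (P : D -> Prop) :
    (forall u v, P u -> P v -> P (u + v)) ->
    (forall c i j, P (c%:P%:P * torus_monom K i j)) ->
  forall f, P f.
Proof.
move=> PD PM f; have P0 : P 0 by have := PM 0 0%N 0%N; rewrite polyC0 mul0r.
rewrite -[f]coefK poly_def; apply: big_ind => // i _.
rewrite -[f`_i]coefK poly_def scaler_suml; apply: big_ind => // j _.
have := PM f`_i`_j i j; congr (P _).
by rewrite /torus_monom mulrA -polyCM !mul_polyC.
Qed.

(** The involution (s, t) -> (-s, -t). *)
Definition torus_neg : D -> D :=
  comp_poly (- 'X) \o map_poly (comp_poly (- 'X)).

HB.instance Definition _ := GRing.RMorphism.on torus_neg.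

Lemma torus_negC c : torus_neg c%:P%:P = c%:P%:P.
Proof. by rewrite /torus_neg /= map_polyC /= !comp_polyC. Qed.

Lemma torus_negX : torus_neg 'X = - 'X.
Proof. by rewrite /torus_neg /= map_polyX comp_polyX. Qed.

Lemma torus_negY : torus_neg 'X%:P = - 'X%:P.
Proof. by rewrite /torus_neg /= map_polyC /= comp_polyX comp_polyC polyCN. Qed.

Lemma torus_neg_monom i j : torus_neg (torus_monom K i j) = (-1) ^+ (i + j) * torus_monom K i j.
Proof.
rewrite /torus_monom polyC_exp rmorphM !rmorphXn /= torus_negX torus_negY.
by rewrite (exprNn 'X) (exprNn 'X%:P) exprD; ring.
Qed.

End Torus.

Section Regular.
Variables (K : fieldType) (n : nat).
Implicit Types i j k l : 'I_n.
Local Notation S := {mpoly K[#|{: upper_index n}|]}.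
Local Notation D := {poly {poly K}}.
Local Notation R := (sym_perm_quot K n).
Local Notation y i j := ('X_(sym_var i j) : S).

Lemma torus_neg_pair_map k l (u : S) : torus_neg (pair_map k l u) = pair_map k l u.
Proof.
elim/mpoly_ring_ind: u => [c|i|u v IHu IHv|u v IHu IHv].
- by rewrite pair_mapC torus_negC.
- have param1 j : torus_neg (pair_param K k l j) = - pair_param K k l j.
    rewrite /pair_param; case: ifP => _; first exact: torus_negX.
    by case: ifP => _; rewrite ?torus_negY // rmorph0 oppr0.
  have sgn (b : bool) : torus_neg (if b then -1 else 1) = if b then -1 else 1 :> D.
    have neg1 : torus_neg 1 = 1 :> D by have := torus_negC (1 : K); rewrite !polyC1.
    have negN1 : torus_neg (-1) = -1 :> D.
      by have := torus_negC (-1 : K); rewrite !polyCN !polyC1.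
    by case: b.
  by rewrite (sym_varE i) pair_map_var /pair_entry !rmorphM /= !param1 mulrNN sgn.
- by rewrite !rmorphD /= IHu IHv.
- by rewrite !rmorphM /= IHu IHv.
Qed.

Lemma pair_map_section_monom k l (i j : nat) : k != l -> odd i = odd j ->
  pair_map k l (@pair_section_monom K n k l i j) = torus_monom K i j.
Proof.
move=> kl oij; rewrite /pair_section_monom !rmorphM /= !rmorphXn /=.
have eN : pair_map k l (- y l l) = - pair_map k l (y l l).
  by apply/eqP; rewrite -addr_eq0 -rmorphD addNr rmorph0.
rewrite eN pair_map_kk //.
rewrite pair_map_ll // pair_map_kl // opprK /torus_monom polyC_exp.
rewrite -[in RHS](odd_double_half i) -[in RHS](odd_double_half j) -oij.
rewrite -!muln2 (exprMn (odd i)) (exprD _ _ (i./2 * 2)) (exprD _ _ (j./2 * 2)) !exprM.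
by rewrite (exprAC 'X) (exprAC 'X%:P); ring.
Qed.

(** Twice the average of f over the involution is a combination of monomials
    s^i t^j with i + j even, that is, i and j of the same parity. *)
Lemma pair_map_even k l (f : D) : k != l ->
  exists u : S, pair_map k l u = f + torus_neg f.
Proof.
move=> kl; elim/torus_ind: f => [f g [u eu] [v ev]|c i j].
  by exists (u + v); rewrite rmorphD /= eu ev rmorphD /= addrACA.
rewrite rmorphM /= torus_negC torus_neg_monom.
have [oij|oij] := boolP (odd (i + j)).
  by exists 0; rewrite rmorph0 -signr_odd oij mulN1r mulrN subrr.
exists ((c *+ 2) *: @pair_section_monom K n k l i j).
rewrite pair_mapZ pair_map_section_monom //; last first.
  by move: oij; rewrite oddD; do 2 case: odd.
by rewrite -signr_odd (negPf oij) mul1r !polyCMn mulrnAl.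
Qed.

Hypothesis two_neq0 : 2%:R != 0 :> K.

(** As all indices are in {k, l}, the kernel of [pair_map] is generated by a
    single permanent and R is a subring of K[s,t].  Composing a map of K[s,t] with the
    average over the involution, which is R-linear, gives a map with values in R. *)
Lemma strongly_F_regular_sym_perm_quot2 (p : nat) (k l : 'I_n) : p \in [pchar K] -> k != l ->
  (forall i, i \in [:: k; l]) -> strongly_F_regular p R.
Proof.
move=> chK kl all_kl c c0; pose p0 : pair_index n := exist _ (k, l) kl.
have inj0 (x : R) : quot_map p0 x = 0 -> x = 0.
  have [u ->] := quot_proj_surj x; rewrite quot_map_proj /= => u0.
  apply/quot_proj_eq0; exists 1%N; rewrite expr1.
  apply: (pair_map_ker kl u0); split; first exact: ideal_gen_ideal.
  move=> _ [->|[i [j [out ->]]]]; first exact: P2_quadric.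
  by rewrite /outside_pair !all_kl in out.
have chK' : p \in [pchar {poly K}] by apply: (rmorph_pchar polyC) chK.
have regD : strongly_F_regular p D.
  by do 2![apply: poly_strongly_F_regular => //]; apply: field_strongly_F_regular.
have [|N cN] := regD (quot_map p0 c).
  by apply: contraNneq c0 => /inj0 ->.
exists N => e /cN[f [fD fX] fc].
pose half : D := (2%:R^-1)%:P%:P.
have halfK : half * 2%:R = 1 by rewrite -[2%:R](rmorph_nat (polyC \o polyC)) -!rmorphM /= mulVf.
pose g x := half * (f x + torus_neg (f x)).
have negR (x : R) : torus_neg (quot_map p0 x) = quot_map p0 x.
  by have [u ->] := quot_proj_surj x; rewrite quot_map_proj torus_neg_pair_map.
have [||||h Ch hE] := @lift_cartier R D unit (fun=> quot_map p0) (p ^ e) g.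
- by move=> u /(_ tt)/inj0.
- by move=> x z; rewrite /g fD rmorphD /= addrACA mulrDr.
- by move=> _ a x; rewrite /g fX rmorphM /= negR -mulrDr mulrCA.
- move=> u; have [v ev] := pair_map_even (half * f (quot_map p0 u)) kl.
  exists (quot_proj v) => _; rewrite /= quot_map_proj ev /g mulrDr rmorphM /=.
  by rewrite torus_negC.
have gc1 : g (quot_map p0 c) = 1.
  by have := torus_negC (1 : K); rewrite /g fc !polyC1 => ->; exact: halfK.
exists h => //; apply/eqP; rewrite -subr_eq0; apply/eqP/inj0.
have e1 : quot_map p0 (h c) = 1 by exact: etrans (hE tt c) gc1.
by apply: quot_map_sub; rewrite e1 quot_map1.
Qed.

End Regular.

(** * Purity *)

Section Split.
Variables (K : fieldType) (n : nat).
Implicit Types i j k l x : 'I_n.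
Local Notation S := {mpoly K[#|{: upper_index n}|]}.
Local Notation D := {poly {poly K}}.
Local Notation R := (sym_perm_quot K n).
Local Notation y i j := ('X_(sym_var i j) : S).
Local Notation monom := 'X_{1.. #|{: upper_index n}|}.

(** The grading of K[Y] by Z^n in which y_ij has degree e_i + e_j; [pair_map]
    is homogeneous, with s and t in degrees e_k and e_l. *)
Definition multideg (m : monom) x : nat :=
  \sum_v m v * ((row_of v == x) + (col_of v == x)).

Lemma multidegD m1 m2 x : multideg (m1 + m2)%MM x = (multideg m1 x + multideg m2 x)%N.
Proof. by rewrite -big_split; apply: eq_bigr => v _; rewrite mnmDE mulnDl. Qed.

Lemma multideg_var i j a x :
  multideg (U_(sym_var i j) *+ a)%MM x = (a * ((i == x) + (j == x)))%N.
Proof.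
rewrite /multideg (bigD1 (sym_var i j)) //= big1 => [|v nv]; last first.
  by rewrite mulmnE mnm1E eq_sym (negPf nv).
rewrite mulmnE mnm1E eqxx mul1n addn0.
by have [[-> ->]|[-> ->]] := sym_var_ends i j; rewrite // addnC.
Qed.

(** A block in which m survives shows its whole multidegree, so divisibility of
    the latter by q can be tested there. *)
Lemma pair_map_monomP i j (m : monom) : i != j ->
  pair_map i j ('X_[m] : S) = 0 \/
  exists a b c, 'X_[m] = pair_monom K i j a b c /\
    forall x, multideg m x = ((i == x) * (a.*2 + c) + (j == x) * (b.*2 + c))%N.
Proof.
move=> ij; have [[k [l [m' [out e]]]]|e] := @monom_pairP K n i j m ij.
  by left; rewrite e rmorphM /= pair_map_out // mul0r.
right; exists (m (sym_var i i)), (m (sym_var j j)), (m (sym_var i j)); split.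
  by rewrite {1}e !mpolyXD -!mpolyXn.
move=> x; rewrite {1}e !multidegD !multideg_var.
move: (m _) (m _) (m _) => c b a; case: (i == x); case: (j == x); lia.
Qed.

(** As q is odd, a and b have the same remainder a0 modulo q.  Replacing
    (y_kk y_ll)^a0 by (- y_kl^2)^a0 makes all three exponents divisible by q.  The
    relation holds in every block {i, j}, since the quadric of k, l vanishes
    there. *)
Lemma pair_map_root q k l a b c : odd q -> k != l ->
    (q %| a.*2 + c)%N -> (q %| b.*2 + c)%N ->
  exists s (w : S), forall i j, i != j ->
    pair_map i j (pair_monom K k l a b c) = (-1) ^+ s * pair_map i j w ^+ q.
Proof.
move=> odd_q kl qa qb; have q_gt0 : (0 < q)%N by case: q odd_q {qa qb}.
have cop : coprime q 2 by rewrite coprimen2.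
have ab : (a %% q = b %% q)%N.
  apply/eqP; wlog le_ba : a b qa qb / (b <= a)%N => [IH|].
    have [/IH->//|/ltnW/IH e] := leqP b a; by rewrite eq_sym e.
  rewrite eqn_mod_dvd // -(Gauss_dvdr _ cop).
  by have := dvdn_sub qa qb; rewrite subnDr -doubleB -mul2n.
pose a0 := (a %% q)%N; have qc : (q %| a0.*2 + c)%N.
  move: qa; rewrite {1}(divn_eq a q) doubleD -addnA dvdn_addr //.
  by rewrite -mul2n mulnA dvdn_mull.
exists a0, (pair_monom K k l (a %/ q)%N (b %/ q)%N ((a0.*2 + c) %/ q)%N) => i j ij.
have quad : pair_map i j (y k k) * pair_map i j (y l l) = - pair_map i j (y k l) ^+ 2.
  apply/eqP; rewrite -addr_eq0 -rmorphM -rmorphXn -rmorphD /=.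
  by have := pair_map_perm K ij kl kl; rewrite (sym_varC l k) -expr2 => ->.
rewrite /pair_monom !rmorphM /= !rmorphXn /=.
move: (pair_map i j _) (pair_map i j _) (pair_map i j _) quad => Z3 Z2 Z1 quad.
rewrite !exprMn -!exprM (divnK qc).
rewrite {1}(divn_eq a q) {1}(divn_eq b q) -ab -/a0.
rewrite (exprD Z3 _ c) (exprD Z1) (exprD Z2) -mul2n (exprM Z3).
have <- : (-1) ^+ a0 * (Z1 * Z2) ^+ a0 = (Z3 ^+ 2) ^+ a0.
  by rewrite quad (exprNn (Z3 ^+ 2)) signrMK.
rewrite (exprMn a0 Z1); have := signrMK a0 (1 : D); rewrite mulr1.
by move: ((-1) ^+ a0) => s s2; ring: s2.
Qed.

Hypotheses (two_neq0 : 2%:R != 0 :> K) (n_gt1 : (1 < n)%N).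

(** On K[s,t] let th take the q-th roots of the monomials that are q-th powers and kill
    the others.  It is enough to
    lift, for each monomial of K[Y], its images under th in all blocks at once. *)
Lemma sym_perm_split p e : p \in [pchar K] -> odd p ->
  exists2 f : R -> R, cartier (p ^ e) f & f 1 = 1.
Proof.
move=> chK odd_p; have [la Cla la1] := field_cartier e chK.
have q_gt0 := expn_pchar_gt0 e chK; have nq := pchar_pnat e chK.
have odd_q : odd (p ^ e) by rewrite oddX odd_p orbT.
have nq' : [pchar {poly K}].-nat (p ^ e)%N.
  by apply: pchar_pnat; apply: (rmorph_pchar polyC) chK.
move: (p ^ e)%N q_gt0 nq odd_q nq' Cla => q q_gt0 nq odd_q nq' Cla.
have C1 := poly_cartierP nq q_gt0 Cla.
pose th : D -> D := poly_cartier q 0 (poly_cartier q 0 la).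
have Cth : cartier q th by apply: poly_cartierP.
have [thD thX] := Cth.
have th_torus c (i j : nat) : th (c%:P%:P * torus_monom K i j) =
    if (q %| i)%N && (q %| j)%N then (la c)%:P%:P * torus_monom K (i %/ q)%N (j %/ q)%N else 0.
  rewrite /torus_monom mulrA -polyCM /th poly_cartier_monom //.
  rewrite poly_cartier_monom //; case: (q %| i)%N => //=; case: (q %| j)%N => /=.
    by rewrite polyCM mulrA.
  by rewrite mul0r.
have th_const c : th c%:P%:P = (la c)%:P%:P.
  have := th_torus c 0%N 0%N; rewrite dvdn0 div0n.
  by rewrite /torus_monom !expr0 !mulr1.
have lift (u : S) : exists v : S, forall i j, i != j ->
    pair_map i j v = th (pair_map i j u).
  elim/mpolyind: u => [|c m u _ _ [v ev]].
    by exists 0 => i j _; rewrite !rmorph0 (cartier0 Cth).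
  suff [w ew] : exists w : S, forall i j, i != j ->
      pair_map i j w = th (pair_map i j (c *: 'X_[m])).
    by exists (w + v) => i j ij; rewrite !rmorphD /= thD ew // ev.
  have van i j : i != j -> pair_map i j ('X_[m] : S) = 0 ->
      pair_map i j (0 : S) = th (pair_map i j (c *: 'X_[m])).
    by move=> ij e0; rewrite pair_mapZ e0 mulr0 rmorph0 (cartier0 Cth).
  have [/forallP dvd|/forallPn[x ndvd]] := boolP [forall x, (q %| multideg m x)%N]; last first.
    exists 0 => i j ij; have [|[a [b [c' [em dm]]]]] := pair_map_monomP m ij.
      exact: van.
    rewrite pair_mapZ em pair_map_monom //.
    have -> : (-1) ^+ b = ((-1) ^+ b : K)%:P%:P :> D by rewrite !rmorphXn !rmorphN1.
    rewrite mulrA -!polyCM th_torus rmorph0.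
    case: ifP => // /andP[qa qb]; case/negP: ndvd; rewrite dm.
    by rewrite dvdn_add // dvdn_mull.
  have [[k [l [kl nz]]]|none] :=
    pselect (exists k l, k != l /\ pair_map k l ('X_[m] : S) <> 0); last first.
    exists 0 => i j ij; apply: van => //; apply: contrapT => nz.
    by apply: none; exists i, j.
  have [//|[a [b [c' [em dm]]]]] := pair_map_monomP m kl.
  have lk : (l == k) = false by rewrite eq_sym; apply: negPf.
  have [s [w ew]] : exists s (w : S), forall i j, i != j ->
      pair_map i j (pair_monom K k l a b c') = (-1) ^+ s * pair_map i j w ^+ q.
    apply: pair_map_root => //.
      by have := dvd k; rewrite dm eqxx lk mul1n mul0n addn0.
    by have := dvd l; rewrite dm eqxx (negPf kl) mul1n mul0n.
  exists (la (c * (-1) ^+ s) *: w) => i j ij.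
  rewrite !pair_mapZ em ew //.
  have -> : (-1) ^+ s = ((-1) ^+ s : K)%:P%:P :> D by rewrite !rmorphXn !rmorphN1.
  by rewrite mulrA -!polyCM mulrC [in RHS]mulrC thX th_const.
have [||||f Cf fE] := @lift_cartier R D (pair_index n) (@quot_map K n) q th.
- exact: quot_map_inj.
- exact: thD.
- by move=> p0 a x; apply: thX.
- move=> u; have [u' ->] := quot_proj_surj u; have [v ev] := lift u'.
  exists (quot_proj v) => p0 /=; rewrite !quot_map_proj.
  by case: p0 => -[i j] /= ij; apply: ev.
exists f => //; apply: quot_map_eq => // p0.
have := th_const 1; rewrite la1 !polyC1 => th1.
by rewrite fE /= !quot_map1; apply: th1.
Qed.
End Split.

(** * The theorem *)

Theorem theorem1p3 (K : fieldType) (p : nat) (charKp : p \in [pchar K])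
    (p_gt2 : (2 < p)%N) (n : nat) (n_ge2 : (2 <= n)%N) :
  F_pure p (sym_perm_quot K n) /\
  (F_regular p (sym_perm_quot K n) <-> n = 2%N).
Proof.
have p_prime := pcharf_prime charKp.
have odd_p : odd p by case: (even_prime p_prime) p_gt2 => // ->.
have two_neq0 : 2%:R != 0 :> K.
  by rewrite -(dvdn_pcharf charKp) gtnNdvd.
have chR := pchar_quot n charKp.
split.
  by apply: F_pure_cartier => // e; apply: sym_perm_split.
split=> [regR|n2].
  apply/eqP; rewrite eqn_leq n_ge2 andbT leqNgt; apply/negP.
  by move=> /not_F_regular_sym_perm_quot; apply; eauto.
apply: F_regular_of_strongly => //.
apply: (@strongly_F_regular_sym_perm_quot2 K n two_neq0 p
  (Ordinal (ltnW n_ge2)) (Ordinal n_ge2)) => //.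
by move: n_ge2; rewrite n2 => n_ge2 i; rewrite !inE; case: i => -[|[|]] // ?.
Qed.
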